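(* For every integer $n\ge 0$ there is a bijection between the set $\mathcal{D}^{\mathfrak{D}}(n)$ of Dyck paths of length $2n$ whose $k$-ascents are coloured by Dyck paths of length $2k$ and the set $\mathcal{NC}(n+1)$ of non-crossing trees on $[n+1]$.
   Context: A Dyck path of length $2n$ is a word in the letters $U,D$ with $n$ letters of each kind such that every prefix contains at least as many $U$'s as $D$'s; $\mathcal{D}(n)$ denotes the set of Dyck paths of length $2n$ (so $\mathcal{D}(0)$ consists of the empty path). A $k$-ascent of a Dyck path is a maximal block of $k$ consecutive letters $U$ (not preceded or followed by another $U$). A Dyck path of length $2n$ with $k$-ascents coloured by Dyck paths of length $2k$ is a Dyck path $P$ of length $2n$ together with an assignment, to each ascent of $P$, of a Dyck path of length $2k$, where $k$ is the length of that ascent; $\mathcal{D}^{\mathfrak{D}}(n)$ is the set of all such coloured paths (two coloured paths are equal iff the underlying paths and all colours agree). A non-crossing tree on $[n+1]$ is a tree with vertex set $\{1,\dots,n+1\}$ which can be drawn with the vertices placed on a circle in clockwise order $1,2,\dots,n+1$ and the edges drawn as straight segments no two of which cross (except at common endpoints); $\mathcal{NC}(n+1)$ is the set of such trees. *)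

(* Defs.v *)
From mathcomp Require Import all_boot all_order all_algebra.
From mathcomp Require Import boolp classical_sets set_interval reals trigo.
Set Implicit Arguments.
Unset Strict Implicit.
Unset Printing Implicit Defensive.
Import Order.TTheory GRing.Theory Num.Theory.

(* The letters U and D are the booleans true and false. *)
Local Notation U := true (only parsing).
Local Notation D := false (only parsing).

Definition dyck_word (n : nat) (w : seq bool) : bool :=
  [&& count_mem U w == n, count_mem D w == n
    & [forall i : 'I_(size w).+1,
        count_mem D (take i w) <= count_mem U (take i w)]].

Definition dyck (n : nat) : Type :=
  {w : (n.*2).-tuple bool | dyck_word n w}.

(* The block of k letters starting at position i (counted from 0) is a maximal
   block of U's; reading w past its end yields D, i.e. "not followed by U". *)
Definition is_ascent (w : seq bool) (i k : nat) : bool :=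
  [&& 0 < k, i + k <= size w, take k (drop i w) == nseq k U,
      (0 < i) ==> (nth D w i.-1 != U) & nth D w (i + k) != U].

(* Pairs (starting position, length). *)
Definition ascent (n : nat) (P : dyck n) : Type :=
  {a : 'I_(n.*2) * 'I_(n.*2).+1 | is_ascent (val P) a.1 a.2}.

Definition ascent_length (n : nat) (P : dyck n) (a : ascent P) : nat :=
  (val a).2.

Definition coloured_dyck (n : nat) : Type :=
  {P : dyck n & {dffun forall a : ascent P, dyck (ascent_length a)}}.

Section Graphs.
Variable T : finType.
Implicit Type E : {set {set T}}.

Definition simple_graph E : Prop := forall e, e \in E -> #|e| = 2.

Definition adj E : rel T := [rel x y | [set x; y]%SET \in E].

Definition connected_graph E : Prop := forall x y, connect (adj E) x y.

Definition acyclic_graph E : Prop :=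
  forall c : seq T, 2 < size c -> ~ ucycle (adj E) c.

Definition tree E : Prop :=
  [/\ simple_graph E, connected_graph E & acyclic_graph E].

End Graphs.

Section Drawings.
Variable R : realType.
Local Open Scope ring_scope.
Local Open Scope classical_set_scope.

Definition segment (p q : R * R) : set (R * R) :=
  [set ((1 - t) * p.1 + t * q.1, (1 - t) * p.2 + t * q.2) | t in `[0, 1]].

(* Going clockwise, the angle decreases, by less than a full turn in total. *)
Definition clockwise_on_circle (m : nat) (v : 'I_m -> R * R) : Prop :=
  exists (c : R * R) (r : R) (theta : 'I_m -> R),
    [/\ 0 < r,
        forall i, v i = (c.1 + r * cos (theta i), c.2 + r * sin (theta i))
      & forall i j : 'I_m, (i < j)%N ->
          theta j < theta i /\ theta i - theta j < 2 * pi].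

Definition noncrossing_drawing (m : nat) (E : {set {set 'I_m}})
    (v : 'I_m -> R * R) : Prop :=
  forall x y z w : 'I_m,
    [set x; y]%SET \in E -> [set z; w]%SET \in E ->
    [set x; y]%SET != [set z; w]%SET ->
    forall p, segment (v x) (v y) p -> segment (v z) (v w) p ->
    exists2 u, u \in ([set x; y] :&: [set z; w])%SET & p = v u.

Definition noncrossing_tree (m : nat) (E : {set {set 'I_m}}) : Prop :=
  tree E /\
  exists v : 'I_m -> R * R, clockwise_on_circle v /\ noncrossing_drawing E v.

End Drawings.

(* The vertices 1, ..., m are represented by 0, ..., m - 1 in 'I_m. *)
Definition nc_tree (R : realType) (m : nat) : Type :=
  {E : {set {set 'I_m}} | `[< noncrossing_tree R E >]}.

(* Main.v *)
(* Both sides are counted by the ternary trees with n nodes.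

   A non-crossing tree on an interval [a, b] with a < b is cut at the edge
   joining a to its largest neighbour j: deleting it leaves the component [a, L]
   of a and the component [L + 1, b] of j, and the latter splits at j. This
   gives non-crossing trees on [a, L], [L + 1, j] and [j, b], hence a ternary
   tree.

   On the other side, let C = 1 + x C^2 and F = 1 + x F^3 be the generating
   functions of Dyck paths and of ternary trees. Reading a Dyck path letter by
   letter, the paths from height h, weighted by the number of colourings of
   their ascents, are counted by F^(h+1), because F = C(x F).

   Points in clockwise order on a circle have negatively oriented triples, which
   makes crossing of chords equivalent to interleaving of their endpoints. *)
Require Import Defs.
From HB Require Import structures.
From mathcomp Require Import all_boot all_order all_algebra.
From mathcomp Require Import boolp classical_sets set_interval reals trigo.
From mathcomp Require Import zify ring lra.
From mathcomp Require Import fintype finset.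
Set Implicit Arguments.
Unset Strict Implicit.
Unset Printing Implicit Defensive.

(** * Ternary trees and non-crossing trees on an interval *)

Inductive tern := Leaf | Node of tern & tern & tern.

Fixpoint nodes t :=
  if t is Node t1 t2 t3 then (nodes t1 + nodes t2 + nodes t3).+1 else 0.

(* An edge is a pair (x, y) with x < y. Connectedness and acyclicity are
   expressed by 2-colourings: a colouring constant along edges is constant, and
   each edge is the only bichromatic edge of some colouring. *)
Record nctree_on (a b : nat) (r : rel nat) : Prop := NCTreeOn {
  nct_range : forall x y, r x y -> [&& a <= x, x < y & y <= b];
  nct_nocross : forall x y z w, r x y -> r z w -> x < z -> z < y -> w <= y;
  nct_conn : forall S : nat -> bool, (forall u v, r u v -> S u = S v) ->
    forall x, a <= x <= b -> S x = S a;
  nct_cut : forall x y, r x y -> exists S : nat -> bool, S x != S y /\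
    forall u v, r u v -> (u, v) != (x, y) -> S u = S v }.

(** The graph lives on the vertices [a] to [a + nodes t]. Here [i] is the vertex L + 1 of the cut;
    the blocks of [t2] and [t3] share the vertex [j]. *)
Fixpoint edges t a : rel nat := fun x y =>
  if t is Node t1 t2 t3 then
    let i := (a + nodes t1).+1 in let j := i + nodes t2 in
    [|| (x == a) && (y == j), edges t1 a x y, edges t2 i x y
      | edges t3 j x y]
  else false.

(** * The edges of a ternary tree form a non-crossing tree *)

Lemma edges_range t a x y :
  edges t a x y -> [&& a <= x, x < y & y <= a + nodes t].
Proof.
elim: t a => //= t1 IH1 t2 IH2 t3 IH3 a.
by case/or4P=> [|/IH1|/IH2|/IH3]; lia.
Qed.

Lemma edges_nocross t a x y z w :
  edges t a x y -> edges t a z w -> x < z -> z < y -> w <= y.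
Proof.
elim: t a => //= t1 IH1 t2 IH2 t3 IH3 a.
case/or4P=> [e|e|e|e]; case/or4P=> [e'|e'|e'|e'];
  try (by move: (IH1 _ e e')); try (by move: (IH2 _ e e'));
  try (by move: (IH3 _ e e'));
  try move: (edges_range e); try move: (edges_range e'); lia.
Qed.

Lemma edges_conn t a (S : nat -> bool) :
  (forall u v, edges t a u v -> S u = S v) ->
  forall x, a <= x <= a + nodes t -> S x = S a.
Proof.
elim: t a => [|t1 IH1 t2 IH2 t3 IH3] a inv x /= xab; first by congr S; lia.
pose i := (a + nodes t1).+1; pose j := i + nodes t2.
have [ei ej] : i = (a + nodes t1).+1 /\ j = i + nodes t2 by [].
have Saj : S a = S j by apply: inv; rewrite /= !eqxx.
have S1 y : a <= y <= a + nodes t1 -> S y = S a.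
  by apply: IH1 => u v e; apply: inv; rewrite /= e orbT.
have S2 y : i <= y <= i + nodes t2 -> S y = S i.
  by apply: IH2 => u v e; apply: inv; rewrite /= e !orbT.
have S3 y : j <= y <= j + nodes t3 -> S y = S j.
  by apply: IH3 => u v e; apply: inv; rewrite /= e !orbT.
case: (leqP x (a + nodes t1)) => xi; first by apply: S1; lia.
case: (leqP x j) => xj; last by rewrite Saj; apply: S3; lia.
by rewrite Saj (S2 x) ?(S2 j) //; lia.
Qed.

(** The root edge is cut by the threshold [i]. For an edge inside one part, the colouring given by
    induction is extended by the colour of the vertex where that part is attached: [a] for the first
    part, [j] for the other two. *)
Lemma edges_cut t a x y : edges t a x y -> exists S : nat -> bool,
  S x != S y /\ forall u v, edges t a u v -> (u, v) != (x, y) -> S u = S v.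
Proof.
elim: t a => //= t1 IH1 t2 IH2 t3 IH3 a.
set i := (a + nodes t1).+1; set j := i + nodes t2.
have [ei ej] : i = (a + nodes t1).+1 /\ j = i + nodes t2 by [].
clearbody i j.
case/or4P=> [/andP[/eqP-> /eqP->]|e|e|e].
- exists (fun z => z < i); split=> /=; first by lia.
  move=> u v /= /or4P[/andP[/eqP-> /eqP->]|e|e|e]; rewrite ?eqxx // => _;
    by have := edges_range e; lia.
- have [S [Sxy inv]] := IH1 _ e.
  exists (fun z => if z < i then S z else S a); split=> /=.
    by move: (edges_range e) => r; rewrite !ifT //; lia.
  move=> u v /= /or4P[/andP[/eqP-> /eqP->]|e'|e'|e'] ne.
  + by rewrite ifT ?ifF //; lia.
  + by move: (edges_range e') => r; rewrite (inv u v) // !ifT //; lia.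
  + by move: (edges_range e') => r; rewrite !ifF //; lia.
  + by move: (edges_range e') => r; rewrite !ifF //; lia.
- have [S [Sxy inv]] := IH2 _ e.
  exists (fun z => if i <= z <= j then S z else S j); split=> /=.
    by move: (edges_range e) => r; rewrite !ifT //; lia.
  move=> u v /= /or4P[/andP[/eqP-> /eqP->]|e'|e'|e'] ne.
  + by rewrite ifF ?ifT //; lia.
  + by move: (edges_range e') => r; rewrite !ifF //; lia.
  + by move: (edges_range e') => r; rewrite (inv u v) // !ifT //; lia.
  + move: (edges_range e') => r; rewrite [v <= j]leqNgt.
    have -> /= : j < v by lia.
    rewrite andbF; case: ifP => // uij; congr S; lia.
- have [S [Sxy inv]] := IH3 _ e.
  exists (fun z => if j <= z then S z else S j); split=> /=.
    by move: (edges_range e) => r; rewrite !ifT //; lia.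
  move=> u v /= /or4P[/andP[/eqP-> /eqP->]|e'|e'|e'] ne.
  + by rewrite ifF ?ifT //; lia.
  + by move: (edges_range e') => r; rewrite !ifF //; lia.
  + move: (edges_range e') => r; rewrite ifF; last by lia.
    by case: ifP => // jv; congr S; lia.
  + by move: (edges_range e') => r; rewrite (inv u v) // !ifT //; lia.
Qed.

Lemma edges_nctree t a : nctree_on a (a + nodes t) (edges t a).
Proof.
split; [exact: edges_range | exact: edges_nocross | exact: edges_conn |].
exact: edges_cut.
Qed.

(** * Injectivity: recovering the tree from its edges *)

Lemma edges_root_max t1 t2 t3 a y :
  edges (Node t1 t2 t3) a a y -> y <= (a + nodes t1).+1 + nodes t2.
Proof.
by case/or4P=> [|/edges_range|/edges_range|/edges_range]; lia.
Qed.

(* The component of a left after removing the root edge is [a, a + nodes t1]. *)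
Lemma edges_split_le t1 t2 t3 u1 u2 u3 a :
  (forall x y, edges (Node t1 t2 t3) a x y = edges (Node u1 u2 u3) a x y) ->
  nodes t1 + nodes t2 = nodes u1 + nodes u2 -> nodes u1 <= nodes t1.
Proof.
move=> E e; rewrite leqNgt; apply/negP => lt.
have := @edges_conn u1 a (fun z => z <= a + nodes t1) _ (a + nodes u1).
move=> H; suff: (a + nodes u1 <= a + nodes t1) = (a <= a + nodes t1) by lia.
apply: H; last by lia.
move=> x y xy; move: (edges_range xy) => r.
have : edges (Node t1 t2 t3) a x y by rewrite E /= xy orbT.
by case/or4P=> [|/edges_range|/edges_range|/edges_range]; lia.
Qed.

(** The root edge ends at the largest neighbour of [a], and the component of [a] fixes [nodes t1].
    Once the three intervals agree, the position of an edge tells which subtree it comes from. *)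
Lemma edges_inj t u a : nodes t = nodes u ->
  (forall x y, edges t a x y = edges u a x y) -> t = u.
Proof.
elim: t u a => [|t1 IH1 t2 IH2 t3 IH3] [|u1 u2 u3] a // sz E.
have le12 : nodes t1 + nodes t2 = nodes u1 + nodes u2.
  apply/eqP; rewrite eqn_leq; apply/andP; split=> /=.
    have := @edges_root_max u1 u2 u3 a ((a + nodes t1).+1 + nodes t2).
    by rewrite -E /= !eqxx => /(_ isT); lia.
  have := @edges_root_max t1 t2 t3 a ((a + nodes u1).+1 + nodes u2).
  by rewrite E /= !eqxx => /(_ isT); lia.
have le1 : nodes t1 = nodes u1.
  apply/eqP; rewrite eqn_leq (edges_split_le E) // andbT.
  exact: (edges_split_le (fun x y => esym (E x y)) (esym le12)).
have le2 : nodes t2 = nodes u2 by lia.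
have le3 : nodes t3 = nodes u3 by move: sz => /=; lia.
set i := (a + nodes t1).+1; set j := i + nodes t2.
have E' x y : [|| (x == a) && (y == j), edges t1 a x y, edges t2 i x y
      | edges t3 j x y] =
   [|| (x == a) && (y == j), edges u1 a x y, edges u2 i x y | edges u3 j x y].
  by move: (E x y) => /=; rewrite -le1 -le2.
have [ei ej] : i = (a + nodes t1).+1 /\ j = i + nodes t2 by [].
clearbody i j; clear E.
have ranges x y := (@edges_range t1 a x y, @edges_range u1 a x y,
  @edges_range t2 i x y, @edges_range u2 i x y,
  @edges_range t3 j x y, @edges_range u3 j x y).
congr Node.
- apply: (IH1 _ a le1) => x y.
  by move: (E' x y) (ranges x y) => ? [[[[[]]]]]; lia.
- apply: (IH2 _ i le2) => x y.
  by move: (E' x y) (ranges x y) => ? [[[[[]]]]]; lia.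
- apply: (IH3 _ j le3) => x y.
  by move: (E' x y) (ranges x y) => ? [[[[[]]]]]; lia.
Qed.

(** * Surjectivity: restricting and cutting a non-crossing tree *)

Definition within (c d : nat) (r : rel nat) : rel nat :=
  fun x y => [&& r x y, c <= x & y <= d].

(* A 2-colouring of [c, d] extends to [a, b] by colouring each outer vertex
   like the vertex of [c, d] at which its part is attached. *)
Lemma nctree_within a b c d (r : rel nat) (attach : nat -> nat) :
  nctree_on a b r -> a <= c <= d -> d <= b ->
  (forall x, c <= x <= d -> attach x = x) ->
  (forall x y, r x y -> ~~ within c d r x y -> attach x = attach y) ->
  nctree_on c d (within c d r).
Proof.
move=> [rg nc cn ct] acd db at_id at_inv; split.
- by move=> x y /and3P[/rg]; lia.
- by move=> x y z w /and3P[/nc xy _ _] /and3P[/xy zw _ _]; apply: zw.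
- move=> S inv x xcd.
  have ext y : a <= y <= b -> S (attach y) = S (attach a).
    apply: cn (fun y => S (attach y)) _ y => u v uv.
    case: (boolP (within c d r u v)) => [uvw|/(at_inv _ _ uv)-> //].
    have /and3P[/rg ruv cu vd] := uvw.
    by rewrite !at_id ?(inv _ _ uvw) //; lia.
  have := ext c; rewrite -(ext x); last by lia.
  by rewrite !at_id => [->||]; lia.
- move=> x y /and3P[/ct [S [Sxy inv]] _ _]; exists S; split=> // u v.
  by case/and3P=> uv _ _; apply: inv.
Qed.

Section Surjectivity.
Variables (a b : nat) (r : rel nat).
Hypotheses (lt_ab : a < b) (nct : nctree_on a b r).

Lemma nctree_root : exists j, r a j /\ forall y, r a y -> y <= j.
Proof.
have [rg _ cn _] := nct.
have ex : exists y, r a y.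
  case: (boolP [exists y : 'I_b.+1, r a y]) => [/existsP[y ray]|].
    by exists y.
  rewrite negb_exists => /forallP none.
  (* Without a neighbour, [a] alone would be an invariant colour class. *)
  have := cn (fun x => x == a) _ b; rewrite eqxx => H.
  suff: (b == a) = true by lia.
  apply: H; last by lia.
  move=> u v uv; have := rg _ _ uv => ruv.
  have vb : v < b.+1 by lia.
  have : u != a by apply: contraNneq (none (Ordinal vb)) => <-.
  lia.
have bd y : r a y -> y <= b by move=> /rg; lia.
by case: (ex_maxnP ex bd) => j raj mx; exists j.
Qed.

(** * The component [P] of [a] without the root edge, as a colour class *)

Section Split.
Variables (j : nat) (P : pred nat).
Hypotheses (raj : r a j) (mx : forall y, r a y -> y <= j).
Hypotheses (Pa : P a) (Pj : ~~ P j).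
Hypothesis Pinv : forall u v, r u v -> (u, v) != (a, j) -> P u = P v.

Lemma part_edge u v : r u v -> P v -> P u /\ v <> j.
Proof.
move=> uv Pv; have vj : v != j by apply: contraTneq Pv => ->.
split; last exact/eqP.
by rewrite (Pinv uv) // xpair_eqE (negbTE vj) andbF.
Qed.

Lemma part_edgeN u v : r u v -> ~~ P v -> u <> a \/ v <> j -> ~~ P u.
Proof.
move=> uv Pv ne; rewrite (Pinv uv) // xpair_eqE; apply/negP.
by case/andP=> /eqP ua /eqP vj; case: ne.
Qed.

(** The vertices of [P] beyond [j] would form an invariant class without [a]: an edge entering it
    would cross the root edge, or start at [a] and pass its largest neighbour. *)
Lemma part_lt x : P x -> x <= b -> x < j.
Proof.
have [rg nc cn _] := nct; have rj := rg _ _ raj.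
move=> Px xb; rewrite ltnNge; apply/negP => jx.
have xj : j < x by rewrite ltn_neqAle jx andbT; apply: contraTneq Px => <-.
have ja : (j < a) = false by clear -rj; lia.
have := cn (fun z => P z && (j < z)) _ x; rewrite Px xj ja andbF /=.
suff inv u v : r u v -> P u && (j < u) = P v && (j < v).
  move/(_ inv) => H; suff: true = false by [].
  by apply: H; clear -xb rj jx; lia.
move=> uv; have ruv := rg _ _ uv.
case: (boolP (P v)) => Pv /=.
  have [Pu vj] := part_edge uv Pv.
  have uj : u <> j by move=> uj; move: Pj; rewrite -uj Pu.
  have ua : u = a -> v <= j by move=> ua; apply: mx; rewrite -ua.
  have := nc _ _ _ _ raj uv; rewrite Pu; clear -ua ruv vj uj; lia.
case: (eqVneq u a) => [->|ua]; first by rewrite ja andbF.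
by rewrite (negbTE (part_edgeN uv Pv _)) //; left; apply/eqP.
Qed.

(** Serves to show that lying under a fixed edge is constant along edges that are disjoint from it
    and do not cross it. *)
Lemma nocross_between u v p q : p < q ->
  p <> u -> p <> v -> q <> u -> q <> v ->
  (u < p -> p < v -> q <= v) -> (p < u -> u < q -> v <= q) ->
  (u < p < v) = (u < q < v).
Proof. lia. Qed.

(* If x had the other colour, an edge with that colour would jump over y, and
   what it encloses of the colour of y would be disconnected from a. *)
Lemma part_initial x y : a <= x <= y -> y <= b -> P y -> P x.
Proof.
have [rg nc cn _] := nct; have rj := rg _ _ raj.
move=> xr yb Py; apply/negPn/negP => Px.
have yj := part_lt Py yb.
have nP u v : P u -> ~~ P v -> u <> v by move=> Pu Pv uv; rewrite -uv Pu in Pv.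
have xy : x < y.
  by case/andP: xr => _; rewrite leq_eqVlt => /predU1P[/esym/(nP _ _ Py Px)|].
have xb : a <= x <= b by clear -xr yb; lia.
have yr : a <= y <= b by clear -xr yb; lia.
(* This colouring differs at [a] and [x], so it cannot be invariant; yet only an edge with both ends
   outside [P] and passing over [y] could break it. *)
have := cn (fun z => ~~ P z && (z < y)) _ x; rewrite Px xy Pa /=.
suff inv u v : r u v -> ~~ P u && (u < y) = ~~ P v && (v < y).
  by move/(_ inv xb).
move=> uv; have ruv := rg _ _ uv.
case: (boolP (P v)) => Pv /=; first by have [-> _] := part_edge uv Pv.
case: (boolP (P u)) => Pu /=.
  case: (eqVneq v j) => [->|/eqP vj]; first by clear -yj; lia.
  by have := part_edgeN uv Pv (or_intror vj); rewrite Pu.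
have vy := nP _ _ Py Pv.
case: (ltnP u y) => uy; last by clear -uy ruv; lia.
case: (ltnP v y) => // yv; have {vy}yv : y < v by clear -yv vy; lia.
have ua : (u < a) = false by clear -ruv; lia.
(* The vertices of [P] under such an edge include [y] and miss [a], but form an invariant class. *)
have := cn (fun z => P z && (u < z < v)) _ y; rewrite Py uy yv ua /= andbF.
apply=> // p q pq; have rpq := rg _ _ pq.
case: (boolP (P q)) => Pq /=.
  have [Pp _] := part_edge pq Pq; rewrite Pp /=.
  apply: nocross_between (nP _ _ Pp Pu) (nP _ _ Pp Pv) (nP _ _ Pq Pu)
    (nP _ _ Pq Pv) (nc _ _ _ _ uv pq) (nc _ _ _ _ pq uv).
  by case/and3P: rpq.
case: (eqVneq p a) => [->|/eqP pa]; first by rewrite ua andbF.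
by rewrite (negbTE (part_edgeN pq Pq (or_introl pa))).
Qed.

End Split.

(** By [part_initial] and [part_lt] the colour class of [a] is an interval [a, L] with L < j, and
    only the root edge leaves it. An edge starting strictly between [a] and [j] cannot jump over [j]
    without crossing the root edge. *)
Lemma nctree_split j : r a j -> (forall y, r a y -> y <= j) ->
  exists2 L, a <= L < j & forall x y, r x y ->
    [|| (x == a) && (y == j), y <= L, (L < x) && (y <= j) | j <= x].
Proof.
move=> raj mx; have [rg nc cn ct] := nct.
have [S [Saj inv]] := ct _ _ raj.
pose P x := S x == S a.
have Pa : P a by rewrite /P.
have Pj : ~~ P j by rewrite /P eq_sym.
have Pinv u v : r u v -> (u, v) != (a, j) -> P u = P v.
  by move=> uv /(inv _ _ uv) e; rewrite /P e.
have lt := part_lt raj mx Pj Pinv.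
have initial := part_initial raj mx Pa Pj Pinv.
clearbody P; clear inv Saj S cn ct.
have bd y : P y && (y <= b) -> y <= b by case/andP.
have aP : P a && (a <= b) by rewrite Pa ltnW.
case: (ex_maxnP (ex_intro _ a aP) bd) => L /andP[PL Lb] mxL.
have aL := mxL _ aP.
exists L; first by rewrite aL lt.
move=> x y xy; have rxy := rg _ _ xy.
have ncxy := nc _ _ _ _ raj xy.
case: (eqVneq x a) => [xa|/eqP xa].
  have : y <= j by apply: mx; rewrite -xa.
  case: (eqVneq y j) => [//|yj _].
  have -> : y <= L; last by rewrite orbT.
  apply: mxL; rewrite -(Pinv _ _ xy) ?xa ?Pa /=; first by clear -rxy; lia.
  by rewrite xpair_eqE (negbTE yj) andbF.
case: (boolP (P y)) => Py.
  by have -> : y <= L by apply: mxL; rewrite Py /=; clear -rxy; lia.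
have Px := part_edgeN Pinv xy Py (or_introl xa).
have : L < x.
  rewrite ltnNge; apply: contraNN Px => xL; apply: initial Lb PL.
  by rewrite xL; clear -rxy; lia.
clear -ncxy rxy xa; lia.
Qed.

End Surjectivity.

Lemma nctree_edges a b (r : rel nat) : a <= b -> nctree_on a b r ->
  exists2 t, nodes t = b - a & forall x y, r x y = edges t a x y.
Proof.
have [m] := ubnP (b - a); elim: m a b r => // m IH a b r bam.
rewrite leq_eqVlt => /predU1P[<-|ab] nct.
  exists Leaf; first by rewrite subnn.
  by move=> x y; apply/negbTE/negP => /(nct_range nct); lia.
have [j [raj mx]] := nctree_root ab nct.
have [L aLj sp] := nctree_split ab nct raj mx.
have rj := nct_range nct raj.
have rg := nct_range nct.
(* For each part, [attach] sends all outer vertices to one vertex, [a] for [a, L] and [j] for the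
   other two, so that the root edge is respected as well. *)
have [|||t1 s1 e1] := IH a L (within a L r); [lia|lia| |].
  apply: (nctree_within
    (attach := fun x => if x <= L then x else a)) nct _ _ _ _;
    [lia|lia|by move=> x; case: ifP; lia|].
  by move=> x y xy; have := rg _ _ xy; have := sp _ _ xy; rewrite /within xy;
    do 2 case: ifP; lia.
have [|||t2 s2 e2] := IH L.+1 j (within L.+1 j r); [lia|lia| |].
  apply: (nctree_within
    (attach := fun x => if L < x <= j then x else j)) nct _ _ _ _;
    [lia|lia|by move=> x; case: ifP; lia|].
  by move=> x y xy; have := rg _ _ xy; have := sp _ _ xy; rewrite /within xy;
    do 2 case: ifP; lia.
have [|||t3 s3 e3] := IH j b (within j b r); [lia|lia| |].
  apply: (nctree_within
    (attach := fun x => if j <= x then x else j)) nct _ _ _ _;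
    [lia|lia|by move=> x; case: ifP; lia|].
  by move=> x y xy; have := rg _ _ xy; have := sp _ _ xy; rewrite /within xy;
    do 2 case: ifP; lia.
exists (Node t1 t2 t3) => [|x y] /=; first by lia.
rewrite s1 s2 subnKC; last by lia.
rewrite subnKC; last by lia.
rewrite -e1 -e2 -e3 /within.
case xy: (r x y) => /=.
  by have := sp _ _ xy; have := rg _ _ xy; lia.
rewrite !orbF; symmetry; apply: contraFF xy => /andP[/eqP-> /eqP->]; exact: raj.
Qed.

(** * Trees as edge sets *)

Section Trees.
Variable n : nat.
Implicit Types (E : {set {set 'I_n.+1}}) (i j : 'I_n.+1).

(** [inord] sends numbers out of range to 0, hence the explicit bound on [y]. *)
Definition edge_rel E : rel nat :=
  fun x y => [&& x < y, y < n.+1 & [set inord x; inord y]%SET \in E].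

Lemma edge_relE E i j : edge_rel E i j = (i < j) && adj E i j.
Proof. by rewrite /edge_rel ltn_ord !inord_val. Qed.

Lemma adj_sym (T : finType) (E : {set {set T}}) : symmetric (adj E).
Proof. by move=> i j; rewrite /adj /= setUC. Qed.

Lemma adj_neq (T : finType) (E : {set {set T}}) x y :
  simple_graph E -> adj E x y -> x != y.
Proof. by move=> s /s; rewrite cards2; case: eqP. Qed.

Lemma edge_rel_ord E x y : edge_rel E x y ->
  exists i j, [/\ x = i, y = j, i < j & adj E i j].
Proof.
case/and3P=> xy yn e; have xn : x < n.+1 by apply: ltn_trans yn.
by exists (inord x), (inord y); rewrite !inordK.
Qed.

Lemma adj_invariant E (S : nat -> bool) : simple_graph E ->
  (forall u v, edge_rel E u v -> S u = S v) ->
  forall i j, connect (adj E) i j -> S i = S j.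
Proof.
move=> sE inv i j /connectP[p pp ->].
elim: p i pp => //= k p IH i /andP[ik /IH <-].
case: (ltngtP i k) => ltik; last by congr S.
- by apply: inv; rewrite edge_relE ltik.
- by symmetry; apply: inv; rewrite edge_relE ltik adj_sym.
Qed.

Lemma tree_conn E : simple_graph E -> connected_graph E ->
  forall S : nat -> bool, (forall u v, edge_rel E u v -> S u = S v) ->
  forall x, 0 <= x <= n -> S x = S 0.
Proof.
move=> sE cE S inv x /= xn.
have := adj_invariant sE inv (cE (inord x) ord0).
by rewrite inordK.
Qed.

(** The colour class is the component of one end once the edge is removed. If it contained the other
    end, a duplicate-free path between them would close up to a cycle. *)
Lemma tree_cut E : simple_graph E -> acyclic_graph E ->
  forall x y, edge_rel E x y -> exists S : nat -> bool, S x != S y /\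
    forall u v, edge_rel E u v -> (u, v) != (x, y) -> S u = S v.
Proof.
move=> sE aE x y /edge_rel_ord[i [j [-> -> ij eij]]].
pose F := (E :\ [set i; j])%SET.
have subF : subrel (adj F) (adj E).
  by move=> u v; rewrite /adj /F /= !inE => /andP[].
exists (fun z => connect (adj F) i (inord z)); rewrite !inord_val; split.
  rewrite connect0 eq_sym; apply/eqP => /connectP[p0].
  case/shortenP=> p pp up _ {p0} ej.
  apply: (aE (i :: p)).
    (* The path has at least two edges: its ends differ and the edge joining them is gone. *)
    case: p pp up ej => [|k [|l p]] //=.
      by move=> _ _ eji; rewrite eji ltnn in ij.
    by rewrite andbT => ik _ ejk; move: ik; rewrite -ejk /adj /F /= !inE eqxx.
  rewrite /ucycle; apply/andP; split=> //=.
  by rewrite rcons_path -ej adj_sym eij (sub_path subF).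
move=> u v /edge_rel_ord[k [l [-> -> kl ekl]]] ne.
have Fkl : adj F k l.
  rewrite /adj /F /= in_setD1; apply/andP; split; last exact: ekl.
  apply: contraNneq ne => e.
  have : k \in [set i; j]%SET by rewrite -e set21.
  have : l \in [set i; j]%SET by rewrite -e set22.
  rewrite !inE => /orP[]/eqP el /orP[]/eqP ek; move: kl ij;
    by rewrite ek el ?eqxx ?ltnn //; lia.
have sc := sym_connect_sym (@adj_sym _ F).
by rewrite !inord_val; apply: (same_connect_r sc (connect1 Fkl)).
Qed.

Lemma nctree_connected E : simple_graph E -> nctree_on 0 n (edge_rel E) ->
  connected_graph E.
Proof.
move=> sE [_ _ cn _] i j.
have sc := sym_connect_sym (@adj_sym _ E).
pose S z := connect (adj E) i (inord z).
have inv u v : edge_rel E u v -> S u = S v.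
  case/edge_rel_ord=> k [l [-> -> _ kl]]; rewrite /S !inord_val.
  exact: (same_connect_r sc (connect1 kl)).
have Sk (k : 'I_n.+1) : S k = S 0.
  by apply: cn inv _ _; rewrite /= -ltnS ltn_ord.
have : S j by rewrite Sk -(Sk i) /S inord_val connect0.
by rewrite /S inord_val.
Qed.

(** On a cycle, take a colouring whose only bichromatic edge is [{i, j}]. The rest of the cycle
    joins [i] to [j] without this edge, so their colours agree. *)
Lemma nctree_acyclic E : simple_graph E -> nctree_on 0 n (edge_rel E) ->
  acyclic_graph E.
Proof.
move=> sE [_ _ _ ct] [|i [|j [|k p]]] //= _ /andP[].
rewrite /= rcons_path => /and3P[eij ejk /andP[pp ep]] up.
have [S [Sij inv]] : exists S : nat -> bool, S i != S j /\
    forall u v, adj E u v -> [set u; v]%SET != [set i; j]%SET ->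
    S u = S v.
  have nij := adj_neq sE eij.
  wlog ltij : i j nij eij {ejk pp ep up} / i < j.
    move=> W; case: (ltngtP i j) => h; first exact: W.
      have [||S [Sij inv]] := W j i _ _ h; first by rewrite eq_sym.
        by rewrite adj_sym.
      exists S; rewrite eq_sym; split=> // u v uv.
      by rewrite [X in _ != X]setUC; apply: inv.
    by move: nij; rewrite (val_inj h) eqxx.
  have [S [Sij inv]] := ct i j ltac:(by rewrite edge_relE ltij).
  exists S; split=> // u v uv ne.
  case: (ltngtP u v) => h; last by congr S.
    apply: inv; first by rewrite edge_relE h.
    by apply: contraNneq ne => -[/val_inj-> /val_inj->].
  symmetry; apply: inv; first by rewrite edge_relE h adj_sym.
  by apply: contraNneq ne => -[/val_inj-> /val_inj->]; rewrite setUC.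
have along q u : i \notin u :: q -> path (adj E) u q -> S (last u q) = S u.
  elim: q u => //= v q IH u; rewrite !inE !negb_or.
  move=> /and3P[iu iv iq] /andP[uv pq].
  rewrite IH ?inE ?negb_or ?iv //; symmetry; apply: inv => //.
  apply/negP => /eqP e; have : i \in [set u; v]%SET by rewrite e set21.
  by rewrite !inE (negbTE iu) (negbTE iv).
case/and3P: up => iN jN _.
case/negP: Sij; apply/eqP.
have := along (k :: p) j iN; rewrite /= ejk => /(_ pp) <-.
(* The closing edge is not [{i, j}] either, since [j] occurs only once on the cycle. *)
symmetry; apply: inv => //; apply: contraNneq jN => e.
have : j \in [set last k p; i]%SET by rewrite e set22.
rewrite !inE => /orP[/eqP->|/eqP ji]; first exact: mem_last.
by move: iN; rewrite ji inE eqxx.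
Qed.

Lemma treeP E : simple_graph E ->
  (forall x y z w, edge_rel E x y -> edge_rel E z w -> x < z -> z < y ->
    w <= y) ->
  tree E <-> nctree_on 0 n (edge_rel E).
Proof.
move=> sE nc; split=> [[_ cE aE]|nct].
  split=> //; first by move=> x y /and3P[]; lia.
    exact: tree_conn.
  exact: tree_cut.
by split=> //; [apply: nctree_connected | apply: nctree_acyclic].
Qed.

End Trees.

Definition edge_set n t : {set {set 'I_n.+1}} :=
  [set e | [exists i : 'I_n.+1, exists j : 'I_n.+1,
              edges t 0 i j && (e == [set i; j])]]%SET.

Lemma edge_set_simple n t : simple_graph (edge_set n t).
Proof.
move=> e; rewrite inE => /existsP[i /existsP[j /andP[/edges_range r /eqP->]]].
by rewrite cards2; case: eqP => // ij; move: r; rewrite ij ltnn andbF.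
Qed.

Lemma edge_rel_edge_set n t : nodes t = n ->
  edge_rel (edge_set n t) =2 edges t 0.
Proof.
move=> tn x y; apply/idP/idP => [/edge_rel_ord[i [j [-> -> ij]]]|xy].
  rewrite /adj /= inE => /existsP[k /existsP[l /andP[kl /eqP e]]].
  have /and3P[_ ltkl _] := edges_range kl.
  have : i \in [set k; l]%SET by rewrite -e set21.
  have : j \in [set k; l]%SET by rewrite -e set22.
  rewrite !inE => /orP[]/eqP ej /orP[]/eqP ei; move: ij; rewrite ei ej ?ltnn //.
  by rewrite ltnNge ltnW.
have /and3P[_ ltxy yn] := edges_range xy.
have yn' : y < n.+1 by rewrite ltnS -tn.
have xn' : x < n.+1 by apply: ltn_trans yn'.
rewrite /edge_rel ltxy yn' inE /=; apply/existsP; exists (inord x).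
by apply/existsP; exists (inord y); rewrite !inordK // xy eqxx.
Qed.

Lemma simple_graph_ext n (E F : {set {set 'I_n.+1}}) :
  simple_graph E -> simple_graph F -> edge_rel E =2 edge_rel F -> E = F.
Proof.
move=> sE sF EF.
suff sub (A B : {set {set 'I_n.+1}}) : simple_graph A ->
    edge_rel A =2 edge_rel B -> A \subset B.
  by apply/eqP; rewrite eqEsubset !sub // => x y; rewrite EF.
move=> sA AB; apply/subsetP => e eA.
have /eqP/cards2P[i [j [ne ee]]] := sA _ eA.
wlog ltij : i j ne ee / i < j.
  move=> W; case: (ltngtP i j) => h; first exact: (W i j).
    by apply: (W j i) => //; rewrite 1?eq_sym // setUC.
  by case/eqP: ne; apply: val_inj.
by have := AB i j; rewrite !edge_relE ltij /adj /= -ee eA => <-.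
Qed.

(** * Chords of a circle *)

Section Chords.
Import Order.TTheory GRing.Theory Num.Theory.
Variable R : realType.
Implicit Types p q s : (R * R)%type.
Local Open Scope ring_scope.

(** Twice the signed area of the triangle, positive when it is traversed counterclockwise. *)
Definition orient p q s : R :=
  (q.1 - p.1) * (s.2 - p.2) - (q.2 - p.2) * (s.1 - p.1).

Lemma orient_rot p q s : orient p q s = orient q s p.
Proof. rewrite /orient; ring. Qed.

Lemma orient_swap p q s : orient p q s = - orient p s q.
Proof. rewrite /orient; ring. Qed.

Lemma orient_l p q : orient p q p = 0.
Proof. rewrite /orient; ring. Qed.

Lemma orient_r p q : orient p q q = 0.
Proof. rewrite /orient; ring. Qed.

Lemma orient_affine p q s s' (t : R) :
  orient p q ((1 - t) * s.1 + t * s'.1, (1 - t) * s.2 + t * s'.2) =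
  (1 - t) * orient p q s + t * orient p q s'.
Proof. rewrite /orient /=; ring. Qed.

Lemma segmentC p q : segment p q = segment q p.
Proof.
apply/seteqP; split=> _ [t /= t01 <-]; exists (1 - t); rewrite /= ?in_itv /=.
- by move: t01; rewrite in_itv /=; lra.
- by congr pair; ring.
- by move: t01; rewrite in_itv /=; lra.
- by congr pair; ring.
Qed.

(** A product form whose sign can be read off, meant for half the central angles of two consecutive
    arcs. *)
Lemma sin_sum_half (a b : R) :
  sin (a + a) + sin (b + b) - sin (a + a + (b + b)) =
  4 * sin a * sin b * sin (a + b).
Proof.
have -> : a + a + (b + b) = (a + b) + (a + b) by ring.
rewrite !sinD cosD.
have := cos2Dsin2 a; have := cos2Dsin2 b.
move: (sin a) (sin b) (cos a) (cos b) => sa sb ca cb hb ha.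
have -> : 4 * sa * sb * (sa * cb + ca * sb) =
  2 * sb * cb * sa ^+ 2 + 2 * sa ^+ 2 * sb * cb +
  2 * sa * ca * sb ^+ 2 + 2 * sa * ca * sb ^+ 2 by ring.
have {1}-> : sa ^+ 2 = 1 - ca ^+ 2 by rewrite -ha; ring.
have {1}-> : sb ^+ 2 = 1 - cb ^+ 2 by rewrite -hb; ring.
ring.
Qed.

(** The area is a negative multiple of the expression in [sin_sum_half]; [a], [b] and [a + b] are
    half central angles, strictly between 0 and pi. *)
Lemma orient_clockwise (m : nat) (v : 'I_m -> R * R) (i j k : 'I_m) :
  clockwise_on_circle v -> (i < j)%N -> (j < k)%N ->
  orient (v i) (v j) (v k) < 0.
Proof.
move=> [c [r [th [r0 hv hth]]]] ij jk.
have [hij _] := hth _ _ ij; have [hjk _] := hth _ _ jk.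
have [_ hik] := hth _ _ (ltn_trans ij jk).
pose a := (th i - th j) / 2; pose b := (th j - th k) / 2.
have ea : th i = th j + (a + a) by rewrite /a; field.
have eb : th k = th j - (b + b) by rewrite /b; field.
have -> : orient (v i) (v j) (v k) =
    - (r ^+ 2 * (sin (a + a) + sin (b + b) - sin (a + a + (b + b)))).
  rewrite !hv /orient /= ea eb cosB sinB cosD !sinD.
  have := cos2Dsin2 (th j).
  rewrite !cosD.
  move: (sin (th j)) (cos (th j)) (sin a) (cos a) (sin b) (cos b).
  move=> s t sa ca sb cb h.
  transitivity ((t ^+ 2 + s ^+ 2) * - (r ^+ 2 *
   (sa * ca + ca * sa + (sb * cb + cb * sb) -
    ((sa * ca + ca * sa) * (cb * cb - sb * sb) +
     (ca * ca - sa * sa) * (sb * cb + cb * sb))))); first by ring.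
  by rewrite h mul1r.
rewrite sin_sum_half oppr_lt0 mulr_gt0 ?exprn_gt0 //.
have sa : 0 < sin a by apply: sin_gt0_pi; rewrite /a; lra.
have sb : 0 < sin b by apply: sin_gt0_pi; rewrite /b; lra.
have sab : 0 < sin (a + b) by apply: sin_gt0_pi; rewrite /a /b; lra.
by rewrite !mulr_gt0.
Qed.

(** In this convex quadrilateral [d] is twice the signed area, cut along either diagonal. Each
    diagonal divides the other in the ratio of the areas of the two triangles it cuts off. *)
Lemma chords_meet p q s s' :
  orient p q s < 0 -> orient p s s' < 0 -> orient p q s' < 0 ->
  orient q s s' < 0 ->
  exists2 z, segment p s z & segment q s' z.
Proof.
move=> h1 h2 h3 h4.
pose d := orient p q s' + orient q s s'.
have d0 : d < 0 by rewrite /d; lra.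
have dE : d = orient p q s + orient p s s' by rewrite /d /orient; ring.
have d0' : d != 0 by rewrite lt_eqF.
have frac01 (x y : R) : x < 0 -> y < 0 -> d = x + y -> x / d \in `[0, 1].
  move=> x0 y0 e.
  by rewrite in_itv /= ler_ndivrMr // ler_ndivlMr // mul0r mul1r e; lra.
pose t := orient p q s' / d; pose u := orient p q s / d.
exists ((1 - t) * p.1 + t * s.1, (1 - t) * p.2 + t * s.2).
  by exists t => //=; apply: frac01 h3 h4 _.
exists u => /=; first by apply: frac01 h1 h2 dE.
have td : t * d = orient p q s' by rewrite divfK.
have ud : u * d = orient p q s by rewrite divfK.
have lin (x y w : R) : ((1 - w) * x + w * y) * d = (d - w * d) * x + w * d * y.
  by ring.
by congr pair; apply: (mulIf d0'); rewrite !lin td ud /d /orient; ring.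
Qed.

Section Drawing.
Variables (m : nat) (E : {set {set 'I_m}}) (v : 'I_m -> R * R).
Hypothesis vcw : clockwise_on_circle v.
Implicit Types x y z w : 'I_m.

(** Interleaved edges would be the diagonals of a convex quadrilateral, which meet although they
    have no common end. *)
Lemma drawing_nocross x y z w : noncrossing_drawing E v ->
  [set x; y]%SET \in E -> [set z; w]%SET \in E ->
  (x < z)%N -> (z < y)%N -> (w <= y)%N.
Proof.
move=> nc xy zw xz zy; rewrite leqNgt; apply/negP => yw.
have [||||p p1 p2] := @chords_meet (v x) (v z) (v y) (v w);
  try by apply: orient_clockwise => //; lia.
have ne : [set x; y]%SET != [set z; w]%SET.
  apply/eqP => e; have : x \in [set z; w]%SET by rewrite -e set21.
  by rewrite !inE => /orP[]/eqP/(congr1 val) /=; lia.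
have [u] := nc _ _ _ _ xy zw ne p p1 p2.
by rewrite !inE => /andP[/orP[]/eqP-> /orP[]/eqP/(congr1 val)] /=; lia.
Qed.

Lemma orient_outside x y z : (x < y)%N -> (z < x)%N || (y < z)%N ->
  orient (v x) (v y) (v z) < 0.
Proof.
move=> xy /orP[zx|yz]; last exact: orient_clockwise.
by rewrite -orient_rot; apply: orient_clockwise.
Qed.

Lemma orient_inside x y z : (x < z)%N -> (z < y)%N ->
  0 < orient (v x) (v y) (v z).
Proof.
by move=> xz zy; rewrite orient_swap oppr_gt0; apply: orient_clockwise.
Qed.

(** The orientation of the common point relative to the first chord is 0 and is a convex combination
    of those of [z] and [w]. They are not strictly on one side, and non-crossing excludes opposite
    sides. So one of them is [x] or [y], not both as the edges differ, and the point is that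
    vertex. *)
Lemma nocross_meet x y z w p : (x < y)%N -> (z < w)%N ->
  ((x < z)%N -> (z < y)%N -> (w <= y)%N) ->
  ((z < x)%N -> (x < w)%N -> (y <= w)%N) ->
  [set x; y]%SET != [set z; w]%SET ->
  segment (v x) (v y) p -> segment (v z) (v w) p ->
  exists2 u, u \in ([set x; y] :&: [set z; w])%SET & p = v u.
Proof.
move=> xy zw nc1 nc2 ne [s _ sp] [t t01 tp].
have : orient (v x) (v y) p = 0.
  by rewrite -sp orient_affine orient_l orient_r; ring.
rewrite -{1}tp orient_affine.
have t_end : t = 0 \/ t = 1 -> p = v (if t == 0 then z else w).
  move=> [] t0; rewrite -tp t0 ?eqxx ?oner_eq0.
    by rewrite [RHS]surjective_pairing; congr pair; ring.
  by rewrite [RHS]surjective_pairing; congr pair; ring.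
have onchord u : u = x \/ u = y -> orient (v x) (v y) (v u) = 0.
  by case=> ->; rewrite ?orient_l ?orient_r.
move: t01; rewrite /= in_itv /= => /andP[t0 t1].
have side u : [\/ u = x \/ u = y,
    orient (v x) (v y) (v u) < 0 /\ ((u < x) || (y < u))%N |
    0 < orient (v x) (v y) (v u) /\ (x < u < y)%N].
  case: (ltngtP u x) => ux; first by constructor 2; rewrite orient_outside ?ux.
    case: (ltngtP u y) => uy; first by constructor 3; rewrite orient_inside.
      by constructor 2; rewrite orient_outside ?uy ?orbT.
    by constructor 1; right; apply: val_inj.
  by constructor 1; left; apply: val_inj.
have inxy u : u = x \/ u = y -> u \in [set x; y]%SET.
  by rewrite !inE => -[->|->]; rewrite eqxx ?orbT.
case: (side z) => [zxy|[zn zo]|[zp zi]];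
  case: (side w) => [wxy|[wn wo]|[wp wi]] h.
- case/eqP: ne; apply/setP => u; rewrite !inE.
  by case: zxy zw => ->; case: wxy => ->; lia.
- exists z; first by rewrite inE inxy // set21.
  rewrite onchord // mulr0 add0r in h.
  have tz : t = 0 by apply/eqP; move/eqP: h; rewrite mulf_eq0 (lt_eqF wn) orbF.
  by rewrite t_end; [rewrite tz eqxx|left].
- exists z; first by rewrite inE inxy // set21.
  rewrite onchord // mulr0 add0r in h.
  have tz : t = 0 by apply/eqP; move/eqP: h; rewrite mulf_eq0 (gt_eqF wp) orbF.
  by rewrite t_end; [rewrite tz eqxx|left].
- exists w; first by rewrite inE inxy // set22.
  rewrite (onchord w) // mulr0 addr0 in h.
  have tz : t = 1.
    apply/eqP; move/eqP: h.
    by rewrite mulf_eq0 (lt_eqF zn) orbF subr_eq0 eq_sym.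
  by rewrite t_end; [rewrite tz oner_eq0|right].
- suff: (1 - t) * orient (v x) (v y) (v z) + t * orient (v x) (v y) (v w) < 0.
    by rewrite h ltxx.
  by clear -t0 t1 zn wn; nra.
- lia.
- exists w; first by rewrite inE inxy // set22.
  rewrite (onchord w) // mulr0 addr0 in h.
  have tz : t = 1.
    apply/eqP; move/eqP: h.
    by rewrite mulf_eq0 (gt_eqF zp) orbF subr_eq0 eq_sym.
  by rewrite t_end; [rewrite tz oner_eq0|right].
- lia.
- suff: 0 < (1 - t) * orient (v x) (v y) (v z) + t * orient (v x) (v y) (v w).
    by rewrite h ltxx.
  by clear -t0 t1 zp wp; nra.
Qed.

Lemma nocross_drawing : simple_graph E ->
  (forall x y z w, [set x; y]%SET \in E -> [set z; w]%SET \in E ->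
    (x < z)%N -> (z < y)%N -> (w <= y)%N) ->
  noncrossing_drawing E v.
Proof.
move=> sE nc x y z w xy zw ne p.
have nxy : x != y by move: (sE _ xy); rewrite cards2; case: eqP.
have nzw : z != w by move: (sE _ zw); rewrite cards2; case: eqP.
wlog ltxy : x y xy ne nxy / (x < y)%N.
  move=> W; case: (ltngtP x y) => h; first exact: W.
    rewrite segmentC (setUC [set x]%SET) in xy ne *.
    by apply: W => //; rewrite eq_sym.
  by case/eqP: nxy; apply: val_inj.
wlog ltzw : z w zw ne nzw / (z < w)%N.
  move=> W; case: (ltngtP z w) => h; first exact: W.
    rewrite [segment (v z) _]segmentC (setUC [set z]%SET) in zw ne *.
    by apply: W => //; rewrite eq_sym.
  by case/eqP: nzw; apply: val_inj.
by apply: nocross_meet => //; apply: nc.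
Qed.

End Drawing.

Lemma clockwise_exists (m : nat) :
  exists v : 'I_m -> R * R, clockwise_on_circle v.
Proof.
(* The angles differ by less than 1, well below a full turn. *)
pose th (i : 'I_m) : R := - (i%:R / m.+1%:R).
exists (fun i => (0 + 1 * cos (th i), 0 + 1 * sin (th i))).
exists (0, 0), 1, th; split=> // i j ij; split.
  by rewrite /th ltrN2 ltr_pM2r ?invr_gt0 ?ltr0n // ltr_nat.
have pi2 := @pi_ge2 R.
have : (0 : R) <= i%:R / m.+1%:R by rewrite divr_ge0.
have : j%:R / m.+1%:R <= (1 : R).
  by rewrite ler_pdivrMr ?ltr0n // mul1r ler_nat; have := ltn_ord j; lia.
rewrite /th; move: (i%:R / _) (j%:R / _) => p q; lra.
Qed.

End Chords.

(** Crossing depends only on the order of the vertices on the circle, so any clockwise placement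
    serves for the converse. *)
Lemma noncrossing_treeP (R : realType) n (E : {set {set 'I_n.+1}}) :
  noncrossing_tree R E <-> simple_graph E /\ nctree_on 0 n (edge_rel E).
Proof.
have ncE (sE : simple_graph E) :
    (forall x y z w : 'I_n.+1, [set x; y]%SET \in E -> [set z; w]%SET \in E ->
      x < z -> z < y -> w <= y) <->
    (forall x y z w, edge_rel E x y -> edge_rel E z w -> x < z -> z < y ->
      w <= y).
  split=> nc x y z w.
    move=> /edge_rel_ord[i [j [-> -> _ ij]]] /edge_rel_ord[k [l [-> -> _ kl]]].
    exact: nc ij kl.
  move=> xy zw xz zy; case: (leqP w z) => wz; first lia.
  by apply: (nc x y z w) => //; rewrite edge_relE; apply/andP; split=> //; lia.
split=> [[tE [v [vcw vnc]]]|[sE nct]].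
  have [sE _ _] := tE; split=> //; apply/treeP => //; apply/(ncE sE).
  by move=> x y z w; apply: (drawing_nocross vcw vnc).
have nc := nct_nocross nct; split; first exact/treeP.
have [v vcw] := clockwise_exists R n.+1.
by exists v; split=> //; apply: nocross_drawing => //; apply/ncE.
Qed.

(** * Counting *)

(* [cpow d m h] is the coefficient of x^m in F^h, where F = 1 + x F^d. *)
Fixpoint cpow (d m : nat) : nat -> nat := fix go (h : nat) : nat :=
  if h is h'.+1 then go h' + (if m is m'.+1 then cpow d m' (h' + d) else 0)
  else m == 0.

Lemma cpow_h0 d m : cpow d m 0 = (m == 0).
Proof. by case: m. Qed.

Lemma cpow0 d h : cpow d 0 h = 1.
Proof. by elim: h => //= h ->. Qed.

Lemma cpowS d m h : cpow d m.+1 h.+1 = cpow d m.+1 h + cpow d m (h + d).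
Proof. by []. Qed.

(* With F_d = 1 + x F_d^d, this says
   F_(d+1)^h F_d(x F_(d+1))^g = F_(d+1)^(h+g). *)
Lemma cpow_subst d m g h :
  \sum_(j < m.+1) cpow d j g * cpow d.+1 (m - j) (h + j) = cpow d.+1 m (h + g).
Proof.
elim: m g h => [|m IHm] g h; first by rewrite big_ord1 !cpow0.
elim: g h => [|g IHg] h.
  rewrite big_ord_recl big1 => [|j _]; last by rewrite cpow_h0.
  by rewrite cpow_h0 mul1n subn0 !addn0.
(* Both sides split by the recursion F_d^(g+1) = F_d^g + x F_d^(g+d) and its analogue for d + 1; the
   second halves agree by [IHm] at [g + d] and [h.+1]. *)
rewrite addnS cpowS -IHg big_ord_recl [in RHS]big_ord_recl !cpow0 -addnA.
congr addn; under eq_bigr do rewrite lift0 cpowS mulnDl subSS.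
rewrite big_split /=; congr addn.
have -> : h + g + d.+1 = h.+1 + (g + d) by lia.
by rewrite -IHm; apply: eq_bigr => j _; rewrite addSnnS.
Qed.

(** * Paths from height [h] down to 0, read letter by letter *)

Fixpoint dyck_from h w :=
  match w with
  | [::] => h == 0
  | true :: w' => dyck_from h.+1 w'
  | false :: w' => (0 < h) && dyck_from h.-1 w'
  end.

Lemma dyck_fromP h w :
  reflect (count_mem true w + h = count_mem false w /\
      forall i, count_mem false (take i w) <= count_mem true (take i w) + h)
    (dyck_from h w).
Proof.
elim: w h => [|b w IH] h.
  by apply: (iffP eqP) => [->|[/= <-]].
case: b => /=.
  apply: (iffP (IH _)) => -[e p]; split; try by move: e => /=; lia.
    by case=> // i; have := p i => /=; lia.
  by move=> i; have := p i.+1 => /=; lia.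
apply: (iffP andP) => [[h0 /IH[e p]]|[e p]].
  split; first by move: e => /=; lia.
  by case=> // i; have := p i => /=; lia.
have h0 : 0 < h by have := p 1; rewrite /= take0 /=; lia.
split=> //; apply/IH; split; first by move: e => /=; lia.
by move=> i; have := p i.+1 => /=; lia.
Qed.

Lemma dyck_from_size h w : dyck_from h w -> h <= size w.
Proof.
elim: w h => [|[] w IH] h /=; first by move/eqP->.
  by move/IH; lia.
by case/andP=> _ /IH; lia.
Qed.

Lemma dyck_wordE n (w : (n.*2).-tuple bool) : dyck_word n w = dyck_from 0 w.
Proof.
have sz : count_mem true w + count_mem false w = n.*2.
  rewrite -[RHS](size_tuple w) -(count_predC (pred1 true)); congr addn.
  by apply: eq_count => -[].
apply/and3P/dyck_fromP => [[/eqP eU /eqP eD /forallP p]|[e p]].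
  split=> [|i]; first by rewrite eU eD addn0.
  rewrite addn0; case: (ltnP i (size w).+1) => iw.
    exact: (p (Ordinal iw)).
  by rewrite take_oversize ?eU ?eD // ltnW.
split; try by apply/eqP; lia.
by apply/forallP => i; have := p i; rewrite addn0.
Qed.

Lemma big_tupleS N (F : seq bool -> nat) :
  \sum_(w : N.+1.-tuple bool) F w =
  \sum_(w : N.-tuple bool) F (true :: w) +
  \sum_(w : N.-tuple bool) F (false :: w).
Proof.
rewrite (reindex (fun p : bool * N.-tuple bool => [tuple of p.1 :: p.2])).
  rewrite -(pair_bigA _ (fun b (w : N.-tuple bool) => F (b :: w))) /=.
  by rewrite big_bool.
exists (fun t => (thead t, [tuple of behead t])) => [[b w] _|t _] /=.
  by congr pair; apply: val_inj.
by rewrite [t in RHS]tuple_eta.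
Qed.

(** The first letter leads to height h + 1 with one U fewer to come, or to height h - 1: this is
    C^(h+1) = C^h + x C^(h+2). *)
Lemma sum_dyck_from N m h : N = m.*2 + h ->
  \sum_(w : N.-tuple bool) dyck_from h w = cpow 2 m h.+1.
Proof.
elim: N m h => [|N IH] m h eN.
  rewrite (eq_bigr (fun=> 1)); last by move=> w _; rewrite tuple0 /=; lia.
  by rewrite sum1_card card_tuple; case: m h eN => [|m] [].
rewrite (big_tupleS N (fun w => dyck_from h w)) /=.
have eU : \sum_(w : N.-tuple bool) dyck_from h.+1 w =
    if m is m'.+1 then cpow 2 m' (h + 2) else 0.
  case: m eN => [|m] eN; last by rewrite (IH m) ?addn2 //; lia.
  rewrite big1 // => w _; apply/eqP; rewrite eqb0.
  by apply/negP => /dyck_from_size; rewrite size_tuple; lia.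
rewrite eU addnC; case: h eN {eU} => [|h] eN.
  by rewrite big1 //=; case: m eN.
by rewrite (IH m) //=; [case: m eN | lia].
Qed.

Lemma card_dyck n : #|{: dyck n}| = cpow 2 n 1.
Proof.
rewrite card_sig -sum1_card big_mkcond /= -(@sum_dyck_from n.*2) ?addn0 //.
by apply: eq_bigr => w _; rewrite inE dyck_wordE; case: ifP.
Qed.

(** * Dyck paths weighted by the colourings of their ascents *)

Section Weight.
Variable cat : nat -> nat.
Hypothesis cat0 : cat 0 = 1.

(* The weight of the word U^k w, where an ascent of length l weighs [cat l]. *)
Fixpoint weight k w :=
  match w with
  | [::] => cat k
  | true :: w' => weight k.+1 w'
  | false :: w' => cat k * weight 0 w'
  end.

(* [b] is the letter preceding w; a block of U's at i has length
   [index false (drop i w)]. *)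
Definition ascents_weight b w :=
  \prod_(i < size w)
    (if nth false (b :: w) i then 1 else cat (index false (drop i w))).

Lemma ascents_weight_cons b x w : ascents_weight b (x :: w) =
  (if b then 1 else cat (index false (x :: w))) * ascents_weight x w.
Proof. by rewrite /ascents_weight big_ord_recl. Qed.

Lemma ascents_weight_nil b : ascents_weight b [::] = 1.
Proof. exact: big_ord0. Qed.

Lemma ascents_weight_false w :
  ascents_weight false w = cat (index false w) * ascents_weight true w.
Proof.
case: w => [|x w]; first by rewrite !ascents_weight_nil cat0.
by rewrite !ascents_weight_cons mul1n.
Qed.

(** The [k] pending U's merge with the leading block of [w], so the other blocks are read as if a U
    preceded [w]. *)
Lemma weightE k w :
  weight k w = cat (k + index false w) * ascents_weight true w.
Proof.
elim: w k => [|[] w IH] k /=.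
- by rewrite addn0 ascents_weight_nil muln1.
- by rewrite IH ascents_weight_cons mul1n addSnnS.
- by rewrite IH ascents_weight_cons mul1n addn0 ascents_weight_false.
Qed.

Lemma leading_true v k :
  [&& k <= size v, take k v == nseq k true & nth false v k != true] =
  (k == index false v).
Proof.
elim: v k => [|[] v IH] [|k] //=;
  by rewrite ?take0 ?eqSS -?IH ?eqseq_cons ?andbF.
Qed.

Lemma is_ascentE w i k : i <= size w ->
  is_ascent w i k =
  [&& 0 < k, ~~ nth false (false :: w) i & k == index false (drop i w)].
Proof.
move=> iw; rewrite /is_ascent -leading_true size_drop nth_drop leq_subRL //.
case: i iw => [|i] iw /=; case: (0 < k) => //=.
by rewrite ?eqb_id; do !bool_congr.
Qed.

(** At most one ascent starts at each position, so the product over pairs becomes one over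
    positions. *)
Lemma prod_ascents w N : size w = N ->
  \prod_(a : 'I_N * 'I_N.+1 | is_ascent w a.1 a.2) cat a.2 = weight 0 w.
Proof.
move=> <-; rewrite weightE -ascents_weight_false /ascents_weight.
rewrite -(pair_big_dep xpredT
  (fun (i : 'I_(size w)) (k : 'I_(size w).+1) => is_ascent w i k)
  (fun _ k => cat k)) /=.
apply: eq_bigr => i _.
under eq_bigl do rewrite is_ascentE ?(ltnW (ltn_ord i)) //.
case: nth => /=; first by rewrite big_pred0 // => k; rewrite andbF.
have ub : index false (drop i w) < (size w).+1.
  by rewrite ltnS (leq_trans (index_size _ _)) // size_drop leq_subr.
case E: (index false (drop i w)) ub => [|l] ub.
  (* No ascent starts at a D; the factor there is [cat 0], which is 1. *)
  by rewrite cat0 big_pred0 // => -[[|k] kw].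
rewrite (big_pred1 (Ordinal ub)) // => k /=.
by rewrite -val_eqE /= lt0n; case: eqP => // ->.
Qed.

(** Here [j] counts the U's that still extend the current block of [k] U's, which then ends at
    height h + j; the rest of the path contributes a coefficient of F^(h+j). *)
Lemma sum_weight N m h k : N = m.*2 + h ->
  (forall j, cat j = cpow 2 j 1) ->
  \sum_(w : N.-tuple bool) dyck_from h w * weight k w =
  \sum_(j < m.+1) cat (k + j) * cpow 3 (m - j) (h + j).
Proof.
move=> eN catE; elim: N m h k eN => [|N IH] m h k eN.
  have [-> ->] : m = 0 /\ h = 0 by lia.
  rewrite big_ord1 addn0 muln1 (eq_bigr (fun=> cat k)).
    by rewrite sum_nat_const card_tuple mul1n.
  by move=> w _; rewrite tuple0 /= mul1n.
rewrite (big_tupleS N (fun w => dyck_from h w * weight k w)) /=.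
rewrite big_ord_recl /= !addn0 subn0 addnC; congr addn.
  case: h eN => [|h] eN.
    by rewrite big1 //=; case: m eN => [|m] //; rewrite muln0.
  under eq_bigr do rewrite /= mulnCA.
  rewrite -big_distrr (IH m) /=; last by lia.
  under eq_bigr do rewrite catE.
  (* The sum over [j] collapses because C(x F) = F. *)
  by rewrite (cpow_subst 2) addn1.
case: m eN => [|m] eN.
  rewrite big_ord0 big1 // => w _; apply/eqP; rewrite muln_eq0 eqb0.
  by apply/orP; left; apply/negP => /dyck_from_size; rewrite size_tuple; lia.
rewrite (IH m); last by lia.
by apply: eq_bigr => j _; rewrite /bump leq0n add1n subSS !addSnnS.
Qed.

End Weight.

Lemma big_sig (R : Type) (idx : R) (op : Monoid.com_law idx)
    (T : finType) (P : pred T) (F : T -> R) :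
  \big[op/idx]_(x : {x | P x}) F (val x) = \big[op/idx]_(x | P x) F x.
Proof. exact: esym (big_sub (op := op) P F). Qed.

Lemma card_coloured_dyck n : #|{: coloured_dyck n}| = cpow 3 n 1.
Proof.
pose cat j := cpow 2 j 1.
rewrite card_tagged sumnE big_map big_enum /=.
transitivity (\sum_(w : {w : (n.*2).-tuple bool | dyck_word n w})
    weight cat 0 (val w)).
  apply: eq_bigr => P _; rewrite card_dep_ffun foldrE big_image /=.
  rewrite -(@prod_ascents _ _ (val P) n.*2) ?size_tuple // -[RHS]big_sig.
  by apply: eq_bigr => a _; apply: card_dyck.
rewrite (big_sig _ _ (fun w : (n.*2).-tuple bool => weight cat 0 w)) big_mkcond.
transitivity (\sum_(w : (n.*2).-tuple bool)
    dyck_from 0 w * weight cat 0 w).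
  by apply: eq_bigr => w _; rewrite dyck_wordE; case: ifP; rewrite ?mul1n.
rewrite (@sum_weight cat _ n.*2 n) ?addn0 //.
exact: (cpow_subst 2 n 1 0).
Qed.

(** * Enumeration of ternary trees through forests *)

Lemma tern_comparable : comparable tern.
Proof. by rewrite /comparable /decidable; decide equality. Qed.

HB.instance Definition _ := hasDecEq.Build tern (compareP tern_comparable).

Definition graft (f : seq tern) : seq tern :=
  if f is [:: t1, t2, t3 & f'] then Node t1 t2 t3 :: f' else f.

(** All forests of [h] trees with [m] nodes, by the recursion of [cpow 3]: the first tree is a leaf,
    or deleting its root puts three trees in its place. *)
Fixpoint forests (m : nat) : nat -> seq (seq tern) :=
  fix go (h : nat) : seq (seq tern) :=
  if h is h'.+1 then
    [seq Leaf :: f | f <- go h'] ++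
    (if m is m'.+1 then [seq graft f | f <- forests m' (h' + 3)] else [::])
  else if m is 0 then [:: [::]] else [::].

Definition fsize (f : seq tern) : nat := sumn [seq nodes t | t <- f].

Lemma fsize_graft t1 t2 t3 f :
  fsize (Node t1 t2 t3 :: f) = (fsize [:: t1, t2, t3 & f]).+1.
Proof. by rewrite /fsize /= !addnA. Qed.

Lemma forestsS m h : forests m h.+1 = [seq Leaf :: f | f <- forests m h] ++
  (if m is m'.+1 then [seq graft f | f <- forests m' (h + 3)] else [::]).
Proof. by case: m. Qed.

Lemma size_forests m h : size (forests m h) = cpow 3 m h.
Proof.
elim: m h => [|m IHm]; elim=> //= h IHh; rewrite size_cat !size_map.
  by rewrite IHh.
by rewrite IHh IHm.
Qed.

Lemma graft_inj h : {in [pred f | size f == h + 3] &, injective graft}.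
Proof.
move=> f g; rewrite !inE addn3.
case: f => [|? [|? [|? ?]]] //; case: g => [|? [|? [|? ?]]] //= _ _.
by case=> -> -> -> ->.
Qed.

Lemma mem_forests m h f :
  (f \in forests m h) = (size f == h) && (fsize f == m).
Proof.
elim: m h f => [|m IHm] h; elim: h => [|h IHh] f; rewrite ?forestsS.
- by case: f.
- rewrite cats0; apply/mapP/andP => [[g gin ->]|].
    by move: gin; rewrite IHh => /andP.
  case: f => [|[|t1 t2 t3] f]; rewrite /fsize /= => -[] // sf ff.
  by exists f => //; rewrite IHh; apply/andP.
- by case: f.
rewrite mem_cat; apply/orP/andP => [[/mapP[g gin ->]|/mapP[g gin ->]]|].
- by move: gin; rewrite IHh => /andP.
- move: gin; rewrite IHm addn3; case: g => [|t1 [|t2 [|t3 g]]] //.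
  by rewrite [graft _]/= fsize_graft /= !eqSS => /andP[-> ->].
case: f => [|[|t1 t2 t3] f].
- by case.
- by case=> sf ff; left; apply/mapP; exists f => //; rewrite IHh; apply/andP.
rewrite fsize_graft => -[sf ff]; right; apply/mapP.
exists [:: t1, t2, t3 & f] => //; rewrite IHm addn3.
by apply/andP; split; [move: sf; rewrite /= !eqSS | rewrite -eqSS].
Qed.

Lemma forests_uniq m h : uniq (forests m h).
Proof.
elim: m h => [|m IHm] h; elim: h => [|h IHh] //; rewrite forestsS.
  by rewrite cats0 map_inj_uniq // => f g [].
rewrite cat_uniq map_inj_uniq ?IHh /=; last by move=> f g [].
apply/andP; split.
  apply/hasPn => f /mapP[g gin ->]; apply/mapP => -[g' _].
  by move: gin; rewrite mem_forests addn3; case: g => [|? [|? [|? ?]]].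
rewrite map_inj_in_uniq // => f g; rewrite !mem_forests.
move=> /andP[sf _] /andP[sg _].
exact: graft_inj sf sg.
Qed.

(** The trees with [n] nodes yield each non-crossing tree, by [nctree_edges], and only once, by
    [edges_inj]. *)
Lemma card_nc_tree (R : realType) n : #|{: nc_tree R n.+1}| = cpow 3 n 1.
Proof.
rewrite card_sig -size_forests.
(* The forests listed consist of one tree, so the default of [head] is never taken. *)
pose g f := edge_set n (head Leaf f).
have fP f : f \in forests n 1 -> exists2 t, f = [:: t] & nodes t = n.
  rewrite mem_forests; case: f => [|t [|? ?]] // /andP[_ /eqP e].
  by exists t => //; rewrite -e /fsize /= addn0.
rewrite -(size_map g).
have <- : #|[seq g f | f <- forests n 1]| = size [seq g f | f <- forests n 1].
  apply/card_uniqP; rewrite map_inj_in_uniq ?forests_uniq //.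
  move=> _ _ /fP[t -> tn] /fP[u -> un]; rewrite /g /= => e.
  congr [:: _]; apply: (@edges_inj t u 0); first by rewrite tn un.
  by move=> x y; rewrite -!(@edge_rel_edge_set n) // e.
apply: eq_card => E; rewrite inE; apply/asboolP/mapP => [|[_ /fP[t -> tn] ->]].
  case/noncrossing_treeP=> sE /(nctree_edges (leq0n n))[t tn eE].
  rewrite subn0 in tn; exists [:: t].
    by rewrite mem_forests /fsize /= tn addn0 !eqxx.
  apply: simple_graph_ext => //; first exact: edge_set_simple.
  by move=> x y; rewrite edge_rel_edge_set.
apply/noncrossing_treeP; split; first exact: edge_set_simple.
have := edges_nctree t 0; rewrite add0n tn /g /=.
suff -> : edge_rel (edge_set n t) = edges t 0 by [].
by apply/funext => x; apply/funext => y; apply: edge_rel_edge_set.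
Qed.

Lemma bij_of_card (T U : finType) : #|T| = #|U| ->
  exists f : T -> U, bijective f.
Proof.
move=> e; exists (fun x => enum_val (cast_ord e (enum_rank x))).
exists (fun y => enum_val (cast_ord (esym e) (enum_rank y))) => x.
  by rewrite enum_valK cast_ordK enum_rankK.
by rewrite enum_valK cast_ordKV enum_rankK.
Qed.

Theorem theorem1 (R : realType) (n : nat) :
  exists f : coloured_dyck n -> nc_tree R n.+1, bijective f.
Proof.
by apply: bij_of_card; rewrite card_coloured_dyck card_nc_tree.
Qed.
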